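(* Consider the one-dimensional ($d=1$) total-energy-based discontinuous Galerkin (DG) semi-discretization $$\int_{\kappa}\phi_i\,\partial_t\boldsymbol{y}\,dx-\int_{\kappa}\partial_x\phi_i\,\boldsymbol{\mathcal{F}}(\boldsymbol{y})\,dx+\oint_{\partial\kappa}\phi_i\,\boldsymbol{\mathcal{F}}^{\dagger}(\boldsymbol{y}^{+},\boldsymbol{y}^{-},n)\,ds=0,\qquad i=1,\dots,n_b,$$ of the compressible multicomponent Euler equations on an element $\kappa$, with a general numerical flux $\boldsymbol{\mathcal{F}}^\dagger$. In the case of constant pressure $P=P_0$ and constant velocity $v=v_0$, the discretization preserves velocity equilibrium (i.e., $\partial_t v=0$ necessarily) if and only if the numerical flux satisfies $$P_0\oint_{\partial\kappa}\boldsymbol{\Phi}\,n\,ds-\oint_{\partial\kappa}\boldsymbol{\Phi}\,\mathcal{F}^{\dagger}_{\rho v}(\boldsymbol{y}^{+},\boldsymbol{y}^{-},n)\,ds+v_0\oint_{\partial\kappa}\boldsymbol{\Phi}\sum_{i=1}^{n_s}W_i\,\mathcal{F}^{\dagger}_{C_i}(\boldsymbol{y}^{+},\boldsymbol{y}^{-},n)\,ds=0,$$ where $\mathcal{F}^\dagger_{\rho v}$ is the momentum component of the numerical flux and $\mathcal{F}^\dagger_{C_i}$ is its component corresponding to the $i$th species concentration.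
   Context: State and flux ($d=1$): $\boldsymbol{y}=(\rho v,\rho e_t,C_1,\dots,C_{n_s})^T$, where $C_i$ is the molar concentration of species $i$, $W_i>0$ its molar mass, $\rho=\sum_i W_iC_i>0$ the density, $v$ the velocity, $e_t=u+\tfrac12 v^2$ the specific total energy and $u$ the specific internal energy of the mixture. The flux is $\boldsymbol{\mathcal{F}}(\boldsymbol{y})=(\rho v^2+P,\ v(\rho e_t+P),\ vC_1,\dots,vC_{n_s})^T$, with the pressure $P$ determined by the state through the equation of state (ideal-gas mixture $P=R^0T\sum_iC_i$, with $R^0$ the universal gas constant, and $T$ determined by $\rho u=\sum_i W_iC_iu_i(T)$). DG setting: $\kappa$ is an element (interval) all of whose faces are interior; $n$ is the outward unit normal on $\partial\kappa$ ($\pm1$), and $\oint_{\partial\kappa}(\cdot)\,ds$ is the sum over the two end points. On $\kappa$, $\boldsymbol{y}=\sum_{j=1}^{n_b}\widehat{\boldsymbol{y}}_j(t)\phi_j(x)$, where $\{\phi_1,\dots,\phi_{n_b}\}$ is a basis of the space $\mathcal{P}_p(\kappa)$ of polynomials of degree at most $p$; $\boldsymbol{\Phi}=(\phi_1,\dots,\phi_{n_b})^T$. $\boldsymbol{y}^+$ is the trace from inside $\kappa$ and $\boldsymbol{y}^-$ the trace from the neighboring element. With the mass matrix $\mathcal{M}_{ij}=\int_\kappa\phi_i\phi_j\,dx$, the scheme is equivalent to $\partial_t\boldsymbol{y}=\boldsymbol{\Phi}^T\mathcal{M}^{-1}\big[\int_\kappa\partial_x\boldsymbol{\Phi}\,\boldsymbol{\mathcal{F}}(\boldsymbol{y})dx-\oint_{\partial\kappa}\boldsymbol{\Phi}\,\boldsymbol{\mathcal{F}}^\dagger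 ds\big]$ (componentwise in $\boldsymbol{y}$). Integrals are assumed to be evaluated exactly. The velocity is $v=(\rho v)/\rho$, and its time evolution is $\partial_tv=\frac1\rho\partial_t(\rho v)-\frac{v}{\rho}\partial_t\rho$ with $\partial_t\rho=\sum_iW_i\partial_tC_i$. ''Constant pressure and velocity'' means that at the given time $P\equiv P_0$ and $v\equiv v_0$; ''$\partial_tv=0$'' is meant at that time at every point of $\kappa$. *)

(* Defs.v *)
From mathcomp Require Import all_boot all_order all_algebra.
From mathcomp Require Import qpoly.
From mathcomp Require Import all_classical all_reals all_analysis.
Export numFieldNormedType.Exports.
Set Implicit Arguments.
Unset Strict Implicit.
Unset Printing Implicit Defensive.
Import Order.TTheory GRing.Theory Num.Theory.
Local Open Scope classical_set_scope.
Local Open Scope ring_scope.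

(* Components of y = (rho v, rho e_t, C_1, ..., C_ns). *)
Inductive component (ns : nat) : Type := Mom | Ener | Conc of 'I_ns.
Arguments Mom {ns}.
Arguments Ener {ns}.
Arguments Conc {ns} i.

Definition state (R : realType) (ns : nat) : Type := component ns -> R.

(* [spec_energy i T] is u_i(T), the internal energy of species i per unit
   mass. *)
Record mixture (R : realType) (ns : nat) : Type := Mixture {
  gas_const : R;
  molar_mass : 'I_ns -> R;
  spec_energy : 'I_ns -> R -> R;
  gas_const_gt0 : 0 < gas_const;
  molar_mass_gt0 : forall i, 0 < molar_mass i
}.

Section Thermodynamics.
Variables (R : realType) (ns : nat) (m : mixture R ns).
Implicit Types (y : state R ns) (T : R).

Definition density y : R := \sum_(i < ns) molar_mass m i * y (Conc i).

Definition velocity y : R := y Mom / density y.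

(* rho u = rho e_t - rho v^2 / 2 *)
Definition internal_energy y : R :=
  y Ener - density y * velocity y ^+ 2 / 2.

(* T is an absolute temperature. *)
Definition is_temperature y T : Prop :=
  0 < T /\ internal_energy y =
    \sum_(i < ns) molar_mass m i * y (Conc i) * spec_energy m i T.

(* The second clause says that the state determines its temperature; no sign
   is imposed on the individual concentrations. *)
Definition admissible y : Prop :=
  0 < density y /\ exists! T, is_temperature y T.

(* The default value 0 is never used on admissible states. *)
Definition temperature y : R := xget 0 [set T | is_temperature y T].

Definition pressure y : R :=
  gas_const m * temperature y * \sum_(i < ns) y (Conc i).

Definition flux y : state R ns := fun c =>
  match c with
  | Mom => density y * velocity y ^+ 2 + pressure y
  | Ener => velocity y * (y Ener + pressure y)
  | Conc i => velocity y * y (Conc i)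
  end.

End Thermodynamics.

(* An interval with a basis of the polynomials of degree at most p;
   {poly_n R} is the space of polynomials of degree less than n. *)
Record element (R : realType) (p nb : nat) : Type := Element {
  el_left : R;
  el_right : R;
  el_basis : nb.-tuple {poly_p.+1 R};
  el_lt : el_left < el_right;
  el_basisP : basis_of fullv el_basis
}.

Inductive face : Type := LeftFace | RightFace.

Section DG.
Variables (R : realType) (ns p nb : nat) (m : mixture R ns).
Implicit Types (K : element R p nb) (c : component ns).

Definition el_set K : set R := `[el_left K, el_right K].

Definition basis_poly K (j : 'I_nb) : {poly R} :=
  val (tnth (el_basis K) j).

(* The coefficients of the expansion of y on an element at a given time. *)
Definition coeffs : Type := 'I_nb -> state R ns.

Definition dg_state K (Y : coeffs) (x : R) : state R ns := fun c =>
  \sum_(j < nb) Y j c * (basis_poly K j).[x].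

Definition face_point K (s : face) : R :=
  match s with LeftFace => el_left K | RightFace => el_right K end.

Definition face_normal (s : face) : R :=
  match s with LeftFace => -1 | RightFace => 1 end.

Definition oint (g : face -> R) : R := g LeftFace + g RightFace.

Definition interior_trace K (Y : coeffs) (s : face) : state R ns :=
  dg_state K Y (face_point K s).

(* KL and KR are the left and right neighbors of the element considered. *)
Definition exterior_trace KL (YL : coeffs) KR (YR : coeffs) (s : face)
    : state R ns :=
  match s with
  | LeftFace => dg_state KL YL (el_right KL)
  | RightFace => dg_state KR YR (el_left KR)
  end.

(* Arguments: interior state, exterior state, outward unit normal. *)
Definition numerical_flux : Type :=
  state R ns -> state R ns -> R -> state R ns.

(* The semi-discretization on K at time t, with exterior traces ym. *)
Definition dg_scheme (Fnum : numerical_flux) K (ym : face -> state R ns)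
    (Y : R -> coeffs) (t : R) : Prop :=
  forall (i : 'I_nb) c,
    \int[lebesgue_measure]_(x in el_set K)
        ((basis_poly K i).[x] * derive1 (fun s => dg_state K (Y s) x c) t)
    - \int[lebesgue_measure]_(x in el_set K)
        ((deriv (basis_poly K i)).[x] * flux m (dg_state K (Y t) x) c)
    + oint (fun s => (basis_poly K i).[face_point K s]
        * Fnum (interior_trace K (Y t) s) (ym s) (face_normal s) c)
    = 0.

(* Pressure P0 and velocity v0 at every point of K. *)
Definition equilibrium K (Y : coeffs) (P0 v0 : R) : Prop :=
  forall x, el_set K x ->
    [/\ admissible m (dg_state K Y x),
        pressure m (dg_state K Y x) = P0 &
        velocity m (dg_state K Y x) = v0].

(* "The time derivative of v necessarily vanishes": for every evolution of
   the coefficients that passes through Y0 at time t and obeys the scheme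
   there. *)
Definition preserves_velocity (Fnum : numerical_flux) K
    (ym : face -> state R ns) (Y0 : coeffs) (t : R) : Prop :=
  forall Y : R -> coeffs,
    Y t = Y0 ->
    (forall j c, derivable (fun s => Y s j c) t 1) ->
    dg_scheme Fnum K ym Y t ->
    forall x, el_set K x ->
      is_derive t 1 (fun s => velocity m (dg_state K (Y s) x)) 0.

End DG.

(* Main.v *)
Require Import Defs.
From HB Require Import structures.
From mathcomp Require Import all_boot all_order all_algebra.
From mathcomp Require Import qpoly.
From mathcomp Require Import all_classical all_reals all_analysis.
From mathcomp Require Import ring.
Import Order.TTheory GRing.Theory Num.Theory.
Local Open Scope classical_set_scope.
Local Open Scope ring_scope.

(** Where the velocity is [v], its rate of change is the quotient by the density
    of
      d(rho v)/dt - v d(rho)/dt.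
    This is a fixed linear combination, called [drift] below, of the rates of
    the state components.  Being linear, it acts on the whole discretization
    at once: on the rates of the expansion coefficients, on the polynomial they
    define on the element, and on the right-hand sides of the scheme.

    The numerator of dv/dt is therefore a polynomial in the space of the
    scheme.  It vanishes on the element iff it is the zero polynomial
    ([velocity_stationaryP]), iff its integrals against all basis functions
    vanish ([galerkin_orthogonal_eq0], since a polynomial orthogonal to itself
    is zero).  By the scheme, these integrals are the drifts of the right-hand
    sides ([drift_poly_eq0P]), so they depend on the given state only and not
    on the evolution chosen.

    It remains to compute them ([drift_residual]).  When the pressure is [P0]
    and the velocity [v0], the momentum flux is rho v0^2 + P0 and the flux of
    C_i is v0 C_i, so the drift of the flux is the constant P0, and its
    integral against the derivative of a basis function is a boundary term.
    What is left is exactly the compatibility condition on the numerical flux.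

    If the condition fails, some evolution obeying the scheme must exist for
    the velocity to be seen changing: the mass matrix is invertible, so rates
    satisfying the scheme exist ([galerkin_solve]) and an affine evolution
    realizes them ([evolution_with_rates]). *)

(** * Integrals of polynomials over an interval *)

Lemma integrable_horner {R : realType} (a b : R) (q : {poly R}) :
  lebesgue_measure.-integrable `[a, b] (EFin \o horner q).
Proof.
apply: continuous_compact_integrable; first exact: segment_compact.
exact/continuous_subspaceT/continuous_horner.
Qed.

(** A name for this functional on polynomials lets it carry a linear structure,
    so that the generic lemmas on linear maps apply to it. *)
Definition poly_integral {R : realType} (a b : R) (q : {poly R}) : R :=
  \int[lebesgue_measure]_(x in `[a, b]) q.[x].

Lemma poly_integral_is_linear {R : realType} (a b : R) :
  linear_for *%R (poly_integral a b).
Proof.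
move=> k q r; rewrite /poly_integral.
have mI : measurable (`[a, b] : set (measurableTypeR R)) by [].
transitivity (\int[lebesgue_measure]_(x in `[a, b]) (k * q.[x] + r.[x])).
  by apply: eq_Rintegral => x _; rewrite hornerD hornerZ.
have ikq : lebesgue_measure.-integrable `[a, b]
    (EFin \o (fun x => k * q.[x])).
  have -> : (fun x => k * q.[x]) = horner (k *: q).
    by apply/funext => x; rewrite hornerZ.
  exact: integrable_horner.
rewrite RintegralD//; last exact: integrable_horner.
by rewrite RintegralZl//; exact: integrable_horner.
Qed.

HB.instance Definition _ (R : realType) (a b : R) :=
  GRing.isLinear.Build R {poly R} R *%R (poly_integral a b)
    (poly_integral_is_linear a b).

Lemma poly_integral_deriv {R : realType} (a b : R) (q : {poly R}) :
  a < b -> poly_integral a b q^`() = q.[b] - q.[a].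
Proof.
move=> ab; rewrite /poly_integral /Rintegral.
rewrite (@continuous_FTC2 _ (horner q^`()) (horner q))//.
- exact/continuous_subspaceT/continuous_horner.
- split=> [x _||]; first exact: derivable_horner.
  + exact/cvg_at_right_filter/continuous_horner.
  + exact/cvg_at_left_filter/continuous_horner.
- by move=> x _; rewrite derivE.
Qed.

Definition primitive {R : realType} (q : {poly R}) : {poly R} :=
  \poly_(i < (size q).+1) (q`_i.-1 / i%:R).

Lemma primitiveK {R : realType} (q : {poly R}) : (primitive q)^`() = q.
Proof.
apply/polyP => i; rewrite coef_deriv coef_poly ltnS /=.
case: ltnP => [_|hi]; last by rewrite mul0rn nth_default.
by rewrite -[LHS]mulr_natr mulfVK// pnatr_eq0.
Qed.

(** An interval of positive length holds more points than any given size, here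
    the points [a + (b - a) / i.+1]. *)
Lemma poly_eq0_itv {R : realType} (a b : R) (q : {poly R}) : a < b ->
  {in `[a, b]%R, forall x, q.[x] = 0} -> q = 0.
Proof.
move=> ab q0.
apply: (@roots_geq_poly_eq0 _ _
  [seq a + (b - a) / i.+1%:R | i <- iota 0 (size q)]); last first.
- by rewrite size_map size_iota.
- rewrite map_inj_uniq ?iota_uniq// => i j /addrI.
  have ba0 : b - a != 0 by rewrite subr_eq0 gt_eqF.
  by move=> /(mulfI ba0)/invr_inj/eqP; rewrite eqr_nat => /eqP [].
apply/allP => _ /mapP[i _ ->]; apply/rootP/q0.
have ba0 : 0 < b - a by rewrite subr_gt0.
rewrite in_itv/= lerDl divr_ge0 ?(ltW ba0)//=.
by rewrite -lerBrDl ler_piMr ?(ltW ba0)// invf_le1 ?ler1n ?ltr0n.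
Qed.

(** A primitive of [q * q] is nondecreasing, and it takes the same value at both
    ends when the integral vanishes; so it is constant on the interval, hence
    constant as a polynomial, and its derivative [q * q] is zero. *)
Lemma poly_integral_sqr_eq0 {R : realType} (a b : R) (q : {poly R}) : a < b ->
  poly_integral a b (q * q) = 0 -> q = 0.
Proof.
move=> ab; set Q := primitive (q * q).
have dQ : Q^`() = q * q by exact: primitiveK.
rewrite -dQ poly_integral_deriv// => /eqP; rewrite subr_eq0 => /eqP Qba.
have Qmono x y : a <= x -> x <= y -> y <= b -> Q.[x] <= Q.[y].
  apply: (@ger0_derive1_ndecr R (horner Q)).
  - by move=> z _; exact: derivable_horner.
  - by move=> z _; rewrite -derivE dQ hornerM -expr2 sqr_ge0.
  - exact/continuous_subspaceT/continuous_horner.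
have Qcst : Q - (Q.[a])%:P = 0.
  apply: (poly_eq0_itv a b _ ab) => x; rewrite in_itv/= => /andP[ax xb].
  rewrite hornerD hornerN hornerC; apply/eqP; rewrite subr_eq0 eq_le.
  by rewrite -{1}Qba !Qmono.
have /eqP : q * q = 0 by rewrite -dQ (subr0_eq Qcst) derivC.
by rewrite mulf_eq0 orbb => /eqP.
Qed.

(** * Galerkin projection onto the space of an element *)

Definition dg_poly {R : realType} {ns p nb} (K : element R p nb)
    (Y : coeffs R ns nb) (c : component ns) : {poly R} :=
  \sum_(j < nb) Y j c *: basis_poly K j.

Lemma horner_dg_poly {R : realType} {ns p nb} (K : element R p nb)
    (Y : coeffs R ns nb) (c : component ns) x :
  (dg_poly K Y c).[x] = dg_state K Y x c.
Proof. by rewrite horner_sum; apply: eq_bigr => j _; rewrite hornerZ. Qed.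

Lemma basis_poly_free {R : realType} {p nb} (K : element R p nb)
    (u : 'I_nb -> R) :
  \sum_j u j *: basis_poly K j = 0 -> forall j, u j = 0.
Proof.
move=> u0; have /andP[_ /freeP] := el_basisP K; apply.
apply: val_inj => /=; rewrite -[RHS]u0.
rewrite (raddf_sum (@polyn R p.+1)); apply: eq_bigr => j _.
by rewrite /basis_poly (tnth_nth 0).
Qed.

Definition mass_matrix {R : realType} {p nb} (K : element R p nb) : 'M[R]_nb :=
  \matrix_(i, j) poly_integral (el_left K) (el_right K)
    (basis_poly K i * basis_poly K j).

(** Such a [q] is orthogonal to the span of the basis, hence to itself. *)
Lemma galerkin_orthogonal_eq0 {R : realType} {p nb} (K : element R p nb)
    (u : 'I_nb -> R) (q : {poly R} := \sum_j u j *: basis_poly K j) :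
  (forall i, poly_integral (el_left K) (el_right K) (basis_poly K i * q) = 0) ->
  q = 0.
Proof.
move=> orth; apply: (poly_integral_sqr_eq0 _ _ _ (el_lt K)).
rewrite {1}/q mulr_suml linear_sum big1// => j _.
by rewrite -scalerAl linearZ /= orth mulr0.
Qed.

(** A vector [w] in the kernel of the mass matrix gives the coefficients of a
    polynomial orthogonal to every basis function. *)
Lemma mass_matrix_unit {R : realType} {p nb} (K : element R p nb) :
  mass_matrix K \in unitmx.
Proof.
rewrite -unitmx_tr -row_free_unit -kermx_eq0; apply/eqP/row_matrixP => k.
rewrite row0; set w := row k _.
have wM : w *m (mass_matrix K)^T = 0 by rewrite /w -row_mul mulmx_ker row0.
apply/rowP => j; rewrite [RHS]mxE; move: j; apply: (basis_poly_free K).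
apply: galerkin_orthogonal_eq0 => i.
have := congr1 (fun v : 'rV_nb => v 0 i) wM; rewrite !mxE => <-.
rewrite mulr_sumr linear_sum; apply: eq_bigr => j _.
by rewrite -scalerAr linearZ /= !mxE.
Qed.

(** The rates of a DG solution can be prescribed through their integrals against
    the basis functions, separately for each component. *)
Lemma galerkin_solve {R : realType} {ns p nb} (K : element R p nb)
    (r : 'I_nb -> component ns -> R) : exists A : coeffs R ns nb,
  forall i c, poly_integral (el_left K) (el_right K)
    (basis_poly K i * dg_poly K A c) = r i c.
Proof.
exists (fun j c => (invmx (mass_matrix K) *m \col_i r i c) j 0) => i c.
rewrite /dg_poly mulr_sumr linear_sum.
transitivity ((mass_matrix K *m (invmx (mass_matrix K) *m \col_i r i c)) i 0).
  rewrite [RHS]mxE; apply: eq_bigr => j _.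
  by rewrite -scalerAr linearZ /= [mass_matrix K i j]mxE mulrC.
by rewrite mulKVmx ?mass_matrix_unit// mxE.
Qed.

(** * The rate of change of the velocity *)

(** For [y] the time derivative of a state of velocity [v], this is the density
    times the time derivative of the velocity. *)
Definition drift {R : realType} {ns} (m : mixture R ns) (v : R)
    (y : state R ns) : R :=
  y Mom - v * density m y.

Lemma is_derive_velocity {R : realType} {ns} (m : mixture R ns)
    (y : R -> state R ns) (dy : state R ns) (t : R) :
  density m (y t) != 0 ->
  (forall c, is_derive t 1 (fun s => y s c) (dy c)) ->
  is_derive t 1 (fun s => velocity m (y s))
    (drift m (velocity m (y t)) dy / density m (y t)).
Proof.
move=> rho0 dyP.
have drho : is_derive t 1 (fun s => density m (y s)) (density m dy).
  have -> : (fun s => density m (y s)) =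
      \sum_(i < ns) molar_mass m i \*: (fun s => y s (Conc i)).
    by apply/funext => s; rewrite fct_sumE.
  by apply: is_derive_sum => i; exact: is_deriveZ.
have dV := @is_deriveV R (fun s => density m (y s)) t _ 1 rho0 drho.
apply: is_derive_eq (is_deriveM (dyP Mom) dV) _.
rewrite /drift /velocity /GRing.scale /=; field.
exact: rho0.
Qed.

Definition rates {R : realType} {ns nb} (Y : R -> coeffs R ns nb) (t : R) :
    coeffs R ns nb :=
  fun j c => derive1 (fun s => Y s j c) t.

Lemma is_derive_dg_state {R : realType} {ns p nb} (K : element R p nb)
    (Y : R -> coeffs R ns nb) (t x : R) (c : component ns) :
  (forall j c, derivable (fun s => Y s j c) t 1) ->
  is_derive t 1 (fun s => dg_state K (Y s) x c) (dg_state K (rates Y t) x c).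
Proof.
move=> dY.
have -> : (fun s => dg_state K (Y s) x c) =
    \sum_(j < nb) (basis_poly K j).[x] \*: (fun s => Y s j c).
  by apply/funext => s; rewrite fct_sumE; apply: eq_bigr => j _; rewrite mulrC.
have -> : dg_state K (rates Y t) x c =
    \sum_(j < nb) (basis_poly K j).[x] *: rates Y t j c.
  by apply: eq_bigr => j _; rewrite mulrC.
apply: is_derive_sum => j; apply: is_deriveZ.
by rewrite /rates derive1E; exact/derivableP.
Qed.

(** * The scheme as a system for the rates *)

(** The terms of the scheme that are free of time derivatives, moved to the
    right-hand side.  For a fixed test function they form a state, to which
    [drift] applies. *)
Definition dg_residual {R : realType} {ns p nb} (m : mixture R ns)
    (Fnum : numerical_flux R ns) (K : element R p nb)
    (ym : face -> state R ns) (Y : coeffs R ns nb) (i : 'I_nb) :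
    state R ns := fun c =>
  \int[lebesgue_measure]_(x in el_set K)
      ((deriv (basis_poly K i)).[x] * flux m (dg_state K Y x) c)
  - oint (fun s => (basis_poly K i).[face_point K s]
      * Fnum (interior_trace K Y s) (ym s) (face_normal R s) c).

Lemma dg_schemeE {R : realType} {ns p nb} (m : mixture R ns)
    (Fnum : numerical_flux R ns) (K : element R p nb)
    (ym : face -> state R ns) (Y : R -> coeffs R ns nb) (t : R) :
  (forall j c, derivable (fun s => Y s j c) t 1) ->
  dg_scheme m Fnum K ym Y t <->
  forall i c, poly_integral (el_left K) (el_right K)
    (basis_poly K i * dg_poly K (rates Y t) c) =
    dg_residual m Fnum K ym (Y t) i c.
Proof.
move=> dY.
have E i c : \int[lebesgue_measure]_(x in el_set K)
    ((basis_poly K i).[x] * derive1 (fun s => dg_state K (Y s) x c) t) =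
  poly_integral (el_left K) (el_right K)
    (basis_poly K i * dg_poly K (rates Y t) c).
  apply: eq_Rintegral => x _; rewrite hornerM horner_dg_poly derive1E.
  by have [_ ->] := is_derive_dg_state K Y t x c dY.
split=> H i c; have := H i c; rewrite E.
  move/eqP; rewrite -addrA addr_eq0 opprD opprK => /eqP ->.
  by rewrite /dg_residual.
by move=> ->; rewrite /dg_residual; ring.
Qed.

(** * The drift of the discrete solution *)

(** Taking the drift of the coefficients makes this visibly a combination of the
    basis functions, as [galerkin_orthogonal_eq0] needs. *)
Definition drift_poly {R : realType} {ns p nb} (m : mixture R ns) (v : R)
    (K : element R p nb) (A : coeffs R ns nb) : {poly R} :=
  \sum_(j < nb) drift m v (A j) *: basis_poly K j.

Definition density_poly {R : realType} {ns p nb} (m : mixture R ns)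
    (K : element R p nb) (A : coeffs R ns nb) : {poly R} :=
  \sum_(l < ns) molar_mass m l *: dg_poly K A (Conc l).

Lemma horner_density_poly {R : realType} {ns p nb} (m : mixture R ns)
    (K : element R p nb) (A : coeffs R ns nb) x :
  (density_poly m K A).[x] = density m (dg_state K A x).
Proof.
rewrite horner_sum; apply: eq_bigr => l _.
by rewrite hornerZ horner_dg_poly.
Qed.

Lemma drift_polyE {R : realType} {ns p nb} (m : mixture R ns) (v : R)
    (K : element R p nb) (A : coeffs R ns nb) :
  drift_poly m v K A = dg_poly K A Mom - v *: density_poly m K A.
Proof.
rewrite /drift_poly /dg_poly /density_poly.
under eq_bigr do rewrite scalerBl.
rewrite sumrB; congr (_ - _); rewrite scaler_sumr.
under [RHS]eq_bigr do rewrite /dg_poly !scaler_sumr.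
rewrite exchange_big; apply: eq_bigr => j _.
rewrite mulr_sumr scaler_suml; apply: eq_bigr => l _.
by rewrite !scalerA mulrA.
Qed.

Lemma horner_drift_poly {R : realType} {ns p nb} (m : mixture R ns) (v : R)
    (K : element R p nb) (A : coeffs R ns nb) x :
  (drift_poly m v K A).[x] = drift m v (dg_state K A x).
Proof.
by rewrite drift_polyE hornerD hornerN hornerZ horner_dg_poly
  horner_density_poly.
Qed.

(** The volume terms of momentum and of the species combine to
    [P0 * (basis_poly K i)^`()]: the momentum convected at velocity [v0] cancels
    against [v0] times the convected mass.  The derivative then integrates to
    the boundary term in [P0]. *)
Lemma drift_residual {R : realType} {ns p nb} (m : mixture R ns)
    (Fnum : numerical_flux R ns) (K : element R p nb)
    (ym : face -> state R ns) (Y : coeffs R ns nb) (P0 v0 : R) (i : 'I_nb)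
    (phi := fun s => (basis_poly K i).[face_point K s])
    (Fdag := fun s =>
       Fnum (interior_trace K Y s) (ym s) (face_normal R s)) :
  equilibrium m K Y P0 v0 ->
  drift m v0 (dg_residual m Fnum K ym Y i) =
  P0 * oint (fun s => phi s * face_normal R s)
  - oint (fun s => phi s * Fdag s Mom)
  + v0 * oint (fun s => phi s
      * \sum_(l < ns) molar_mass m l * Fdag s (Conc l)).
Proof.
move=> eqK; pose I := poly_integral (el_left K) (el_right K).
pose dphi := (basis_poly K i)^`().
pose rho := density_poly m K Y.
(* Velocity is a quotient of polynomials and pressure is only implicit in the
   state: it is the equilibrium that makes the fluxes polynomial in [x], and
   only on the element. *)
have volE c (q : {poly R}) :
    (forall x, el_set K x -> flux m (dg_state K Y x) c = q.[x]) ->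
    \int[lebesgue_measure]_(x in el_set K)
      (dphi.[x] * flux m (dg_state K Y x) c) = I (dphi * q).
  by move=> Fq; apply: eq_Rintegral => x /set_mem/Fq ->; rewrite hornerM.
have volM := volE Mom (v0 ^+ 2 *: rho + P0%:P).
have volC l := volE (Conc l) (v0 *: dg_poly K Y (Conc l)).
rewrite /drift /density /dg_residual -/dphi volM; last first.
  move=> x /eqK[_ /= -> ->].
  by rewrite hornerD hornerZ hornerC horner_density_poly mulrC.
under eq_bigr => l _.
  rewrite volC; last by move=> x /eqK[_ _ /= ->]; rewrite hornerZ horner_dg_poly.
  rewrite mulrBr; over.
rewrite sumrB.
have -> : \sum_(l < ns) molar_mass m l * I (dphi * (v0 *: dg_poly K Y (Conc l)))
    = v0 * I (dphi * rho).
  rewrite /I /rho /density_poly mulr_sumr linear_sum mulr_sumr.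
  by apply: eq_bigr => l _; rewrite -!scalerAr !linearZ /= mulrCA.
have -> : I (dphi * (v0 ^+ 2 *: rho + P0%:P)) =
    v0 ^+ 2 * I (dphi * rho) + P0 * oint (fun s => phi s * face_normal R s).
  rewrite /I mulrDr linearD -scalerAr linearZ /=; congr (_ + _).
  rewrite mulrC mul_polyC linearZ /= poly_integral_deriv ?el_lt//.
  by rewrite /oint /phi /=; ring.
have -> : \sum_(l < ns) molar_mass m l *
      oint (fun s => phi s * Fdag s (Conc l)) =
    oint (fun s => phi s * \sum_(l < ns) molar_mass m l * Fdag s (Conc l)).
  rewrite /oint !mulr_sumr -big_split; apply: eq_bigr => l _ /=; ring.
by rewrite -/phi; ring.
Qed.

(** [drift] is linear with coefficients that do not depend on the point, so it
    commutes with integration against a basis function. *)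
Lemma drift_poly_eq0P {R : realType} {ns p nb} (m : mixture R ns)
    (v : R) (K : element R p nb) (A r : 'I_nb -> state R ns) :
  (forall i c, poly_integral (el_left K) (el_right K)
    (basis_poly K i * dg_poly K A c) = r i c) ->
  drift_poly m v K A = 0 <-> forall i, drift m v (r i) = 0.
Proof.
move=> Ar.
have E i : poly_integral (el_left K) (el_right K)
    (basis_poly K i * drift_poly m v K A) = drift m v (r i).
  rewrite drift_polyE mulrBr linearB /= Ar -scalerAr linearZ /=.
  rewrite /density_poly mulr_sumr linear_sum; congr (_ - _ * _).
  by apply: eq_bigr => l _; rewrite -scalerAr linearZ /= Ar.
split=> [d0 i|d0]; first by rewrite -E d0 mulr0 linear0.
by apply: galerkin_orthogonal_eq0 => i; rewrite -/(drift_poly m v K A) E.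
Qed.

(** The density is positive on the element, so dv/dt vanishes where its
    numerator does; a polynomial vanishing on the element is zero. *)
Lemma velocity_stationaryP {R : realType} {ns p nb} (m : mixture R ns)
    (K : element R p nb) (Y : R -> coeffs R ns nb) (t P0 v0 : R) :
  equilibrium m K (Y t) P0 v0 ->
  (forall j c, derivable (fun s => Y s j c) t 1) ->
  (forall x, el_set K x ->
     is_derive t 1 (fun s => velocity m (dg_state K (Y s) x)) 0) <->
  drift_poly m v0 K (rates Y t) = 0.
Proof.
move=> eqK dY.
have dv x : el_set K x ->
    0 < density m (dg_state K (Y t) x) /\
    is_derive t 1 (fun s => velocity m (dg_state K (Y s) x))
      ((drift_poly m v0 K (rates Y t)).[x]
         / density m (dg_state K (Y t) x)).
  move=> /eqK[[rho0 _] _ vx]; split=> //.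
  rewrite horner_drift_poly -{1}vx.
  apply: (is_derive_velocity m (fun s => dg_state K (Y s) x)).
    by rewrite gt_eqF.
  by move=> c; exact: is_derive_dg_state.
split=> [v'0|d0 x /dv[_]]; last by rewrite d0 horner0 mul0r.
apply: (poly_eq0_itv _ _ _ (el_lt K)) => x xK.
have [rho0 dvx] := dv x xK.
have := @derive_val _ _ _ _ _ _ _ dvx.
have := @derive_val _ _ _ _ _ _ _ (v'0 x xK) => -> /esym/eqP.
by rewrite mulf_eq0 invr_eq0 (gt_eqF rho0) orbF => /eqP.
Qed.

(** The scheme constrains an evolution at time [t] only through its value and
    its rates there, so an affine evolution realizes any such pair. *)
Lemma evolution_with_rates {R : realType} {ns nb} (Y0 A : coeffs R ns nb)
    (t : R) :
  exists Y : R -> coeffs R ns nb,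
    [/\ Y t = Y0, forall j c, derivable (fun s => Y s j c) t 1 &
        rates Y t = A].
Proof.
exists (fun s j c => Y0 j c + (s - t) * A j c).
have dY j c : is_derive t 1 (fun s => Y0 j c + (s - t) * A j c) (A j c).
  have -> : (fun s => Y0 j c + (s - t) * A j c) =
      horner ((Y0 j c)%:P + A j c *: ('X - t%:P)).
    by apply/funext => s; rewrite !hornerE mulrC.
  apply: is_derive_eq.
  by rewrite derivD derivC derivZ derivXsubC !hornerE.
split.
- by apply/funext => j; apply/funext => c; rewrite subrr mul0r addr0.
- by move=> j c; case: (dY j c).
- apply/funext => j; apply/funext => c.
  by rewrite /rates derive1E; case: (dY j c).
Qed.

(** * Preservation of velocity equilibrium *)

Theorem lemma1 (R : realType) (ns p nb : nat) (m : mixture R ns)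
    (Fnum : numerical_flux R ns)
    (KL K KR : element R p nb)
    (hL : el_right KL = el_left K) (hR : el_right K = el_left KR)
    (t P0 v0 : R) (YL Y0 YR : coeffs R ns nb)
    (eqL : equilibrium m KL YL P0 v0)
    (eqK : equilibrium m K Y0 P0 v0)
    (eqR : equilibrium m KR YR P0 v0) :
  let ym := exterior_trace KL YL KR YR in
  let Fdag := fun s : face => Fnum (interior_trace K Y0 s) (ym s) (face_normal R s) in
  let phi := fun (j : 'I_nb) (s : face) => (basis_poly K j).[face_point K s] in
  preserves_velocity m Fnum K ym Y0 t <->
  (forall j : 'I_nb,
     P0 * oint (fun s => phi j s * face_normal R s)
     - oint (fun s => phi j s * Fdag s Mom)
     + v0 * oint (fun s => phi j s
         * \sum_(i < ns) molar_mass m i * Fdag s (Conc i))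
     = 0).
Proof.
move=> ym Fdag phi.
pose r := dg_residual m Fnum K ym Y0.
have rE j := drift_residual m Fnum K ym Y0 P0 v0 j eqK.
split=> [pres j|cond Y Yt dY].
- have [A Ar] := galerkin_solve K r.
  have [Y [Yt dY YA]] := evolution_with_rates Y0 A t.
  rewrite -rE; move: j; apply/(drift_poly_eq0P m v0 K A r Ar).
  have eqYt : equilibrium m K (Y t) P0 v0 by rewrite Yt.
  rewrite -YA; apply/(velocity_stationaryP m K Y t P0 v0 eqYt dY).
  apply: pres => //; apply/(dg_schemeE _ _ _ _ _ _ dY) => i c.
  by rewrite YA Yt Ar.
- move/(dg_schemeE _ _ _ _ _ _ dY); rewrite Yt => sch.
  have eqYt : equilibrium m K (Y t) P0 v0 by rewrite Yt.
  apply/(velocity_stationaryP m K Y t P0 v0 eqYt dY).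
  by apply/(drift_poly_eq0P m v0 K _ r sch) => i; rewrite rE; exact: cond.
Qed.
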